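(* Let $d\ge 1$, $L>0$, and let $M\ge 2$, $n\ge 1$ be integers. Let $p_1,\dots,p_M\in L_2(\mathbb{R}^d)$ be fixed functions and let $X_1,\dots,X_n$ be i.i.d. random vectors in $\mathbb{R}^d$ with density $p\in\mathcal{P}_0$. Let $\phi_1,\dots,\phi_{M'}$ ($M'\le M$) be an orthonormal basis in $L_2(\mathbb{R}^d)$ of the linear span of $p_1,\dots,p_M$, and define the linear aggregate $$\tilde p_n^{\mathbf L}(x)=\sum_{j=1}^{M'}\hat\lambda_j^{\mathbf L}\phi_j(x),\quad x\in\mathbb{R}^d,\qquad \hat\lambda_j^{\mathbf L}=\frac1n\sum_{i=1}^n\phi_j(X_i).$$ Then $$R_n(\tilde p_n^{\mathbf L},p)\le \min_{\lambda\in\mathbb{R}^M}\|\mathsf{p}_\lambda-p\|^2+\frac{LM}{n}.$$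
   Context: $\|g\|=(\int_{\mathbb{R}^d}g^2(x)\,dx)^{1/2}$ is the $L_2(\mathbb{R}^d)$ norm and $\|\cdot\|_\infty$ the $L_\infty(\mathbb{R}^d)$ norm. $\mathcal{P}_0$ is the class of all probability densities $p$ on $\mathbb{R}^d$ (i.e. $p\ge0$, $\int p=1$) with $\|p\|_\infty\le L$. For $\lambda=(\lambda_1,\dots,\lambda_M)\in\mathbb{R}^M$, $\mathsf{p}_\lambda=\sum_{j=1}^M\lambda_jp_j$. For an estimator $\hat p$ based on the i.i.d. sample $X_1,\dots,X_n$ with density $p$, $R_n(\hat p,p)=E_p^n\|\hat p-p\|^2$, where $E_p^n$ is the expectation with respect to the distribution of $(X_1,\dots,X_n)$. The $p_j$ need not be probability densities. *)

(* Defs.v *)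
From HB Require Import structures.
From mathcomp Require Import all_boot all_order all_algebra.
From mathcomp Require Import all_classical all_reals all_analysis.

Set Implicit Arguments.
Unset Strict Implicit.
Unset Printing Implicit Defensive.

Import Order.TTheory GRing.Theory Num.Theory.
Import numFieldNormedType.Exports.

Local Open Scope classical_set_scope.
Local Open Scope ring_scope.

Section product_power.
Context dT (T : measurableType dT) (R : realType).
Variable mu : {sigma_finite_measure set T -> \bar R}.

Section step.
Variables (k : nat) (nu : {sigma_finite_measure set (k.-tuple T) -> \bar R}).

Definition pair_cons (x : T * k.-tuple T) : k.+1.-tuple T :=
  [tuple of x.1 :: x.2].

Lemma measurable_pair_cons : measurable_fun setT pair_cons.
Proof. exact: (measurable_cons measurable_fst measurable_snd). Qed.

Definition power_step : set (k.+1.-tuple T) -> \bar R :=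
  pushforward (mu \x nu)%E pair_cons.

Let power_step0 : power_step set0 = 0%E.
Proof. by rewrite /power_step /pushforward preimage_set0 measure0. Qed.

Let power_step_ge0 A : (0 <= power_step A)%E.
Proof. by rewrite /power_step /pushforward measure_ge0. Qed.

Let power_step_sigma_additive : semi_sigma_additive power_step.
Proof.
move=> F mF tF mUF; rewrite /power_step /pushforward preimage_bigcup.
apply: measure_semi_sigma_additive.
- by move=> i; rewrite -[X in measurable X]setTI; exact: measurable_pair_cons.
- apply/trivIsetP => /= i j _ _ ij; rewrite -preimage_setI.
  by move/trivIsetP : tF => /(_ i j Logic.I Logic.I ij) ->; rewrite preimage_set0.
- rewrite -preimage_bigcup -[X in measurable X]setTI.
  exact: measurable_pair_cons.
Qed.

HB.instance Definition _ := isMeasure.Build _ _ _ power_step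
  power_step0 power_step_ge0 power_step_sigma_additive.

Let power_step_sigma_finite : sigma_finite setT power_step.
Proof.
have /sigma_finiteP[F [FT ndF Foo]] := sigma_finiteT mu.
have /sigma_finiteP[G [GT ndG Goo]] := sigma_finiteT nu.
pose g (t : k.+1.-tuple T) : T * k.-tuple T := (thead t, [tuple of behead t]).
have mg : measurable_fun setT g.
  apply/measurable_fun_pair; first exact: measurable_tnth.
  exact: measurable_behead.
exists (fun i => g @^-1` (F i `*` G i)).
  apply/esym/seteqP; split => // t _.
  have [i _ Fi] : (\bigcup_i F i) (g t).1 by rewrite -FT.
  have [j _ Gj] : (\bigcup_i G i) (g t).2 by rewrite -GT.
  exists (maxn i j) => //; split.
  - by move: Fi; exact/subsetPset/ndF/leq_maxl.
  - by move: Gj; exact/subsetPset/ndG/leq_maxr.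
move=> i; have [mFi Fioo] := Foo i; have [mGi Gioo] := Goo i; split.
  by rewrite -[X in measurable X]setTI; apply: mg => //; exact: measurableX.
rewrite /power_step /pushforward (_ : pair_cons @^-1` _ = F i `*` G i).
  by rewrite product_measure1E// lte_mul_pinfty// ge0_fin_numE.
apply/funext => -[a t]; rewrite /preimage /setX /=; congr (_ /\ G i _).
exact: val_inj.
Qed.

HB.instance Definition _ := @Measure_isSigmaFinite.Build _ _ _ power_step
  power_step_sigma_finite.

End step.

(* The k-fold product of mu; the library has only binary products. *)
Fixpoint measure_power (k : nat) :
    {sigma_finite_measure set (k.-tuple T) -> \bar R} :=
  match k with
  | 0 => \d_([tuple] : 0.-tuple T)
  | k'.+1 => power_step (measure_power k')
  end.

Lemma measure_power_box (k : nat) (A : 'I_k -> set T) :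
  (forall i, measurable (A i)) ->
  measure_power k [set x | forall i, A i (tnth x i)] = (\prod_(i < k) mu (A i))%E.
Proof.
elim: k A => [|k IH] A mA.
  rewrite big_ord0 /= diracE mem_set//= => -[]//.
rewrite big_ord_recl -IH // -product_measure1E //; last first.
  rewrite (_ : [set _ | _] =
      \bigcap_(i in [set: 'I_k]) ((@tnth k T)^~ i @^-1` A (lift ord0 i))).
    apply: fin_bigcap_measurable => // i _.
    by rewrite -[X in measurable X]setTI; exact: measurable_tnth.
  by apply/seteqP; split => [x Ax i _|x Ax i]; [exact: Ax|exact: (Ax i)].
rewrite /= /power_step /pushforward; congr (_ _).
apply/seteqP; split => -[a t] /=.
  move=> H; split => [|i /=]; first exact: (H ord0).
  by have := H (lift ord0 i); rewrite tnthS.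
move=> [/= Aa At] i; case: (unliftP ord0 i) => [j ->|->//].
by rewrite tnthS; exact: At.
Qed.

End product_power.

(* R^d carries the Borel sigma-algebra, generated by the coordinate maps. *)
Notation Rvec R d := (d.-tuple (measurableTypeR R)) (only parsing).

Definition lebesgue_Rvec (R : realType) (d : nat) :
    {sigma_finite_measure set (Rvec R d) -> \bar R} :=
  measure_power (@lebesgue_measure R) d.

Section L2_Rvec.
Context (R : realType) (d : nat).
Notation leb := (lebesgue_Rvec R d).

(* Elements of L_2 are represented by everywhere-defined Borel functions, so
   that they can be evaluated at the observations. *)
Definition L2 : {pred Rvec R d -> R} := Lfun leb 2%:E.

Definition L2norm (g : Rvec R d -> R) : \bar R := 'N[leb]_2%:E [EFin \o g]%E.

Definition Loonorm (g : Rvec R d -> R) : \bar R := 'N[leb]_+oo [EFin \o g]%E.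

(* Meaningful for f and g in L2, where the integrand is integrable. *)
Definition L2inner (f g : Rvec R d -> R) : R := \int[leb]_x (f x * g x).

Definition lincomb (m : nat) (f : 'I_m -> Rvec R d -> R) (lam : 'rV[R]_m) :
    Rvec R d -> R :=
  fun x => \sum_(j < m) lam ord0 j * f j x.

(* Equality in L_2 is equality almost everywhere. *)
Definition L2span (m : nat) (f : 'I_m -> Rvec R d -> R) : set (Rvec R d -> R) :=
  [set g | g \in L2 /\ exists lam : 'rV[R]_m, g = lincomb f lam %[ae leb]].

Definition orthonormal_basis_of_span (k m : nat)
    (phi : 'I_k -> Rvec R d -> R) (f : 'I_m -> Rvec R d -> R) : Prop :=
  [/\ forall j, phi j \in L2,
      forall i j, L2inner (phi i) (phi j) = (i == j)%:R &
      L2span phi = L2span f].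

(* The class P_0 of probability densities bounded by L. *)
Definition bounded_density (L : R) (p : Rvec R d -> R) : Prop :=
  [/\ measurable_fun setT p,
      forall x, 0 <= p x,
      (\int[leb]_x (p x)%:E = 1)%E &
      (Loonorm p <= L%:E)%E].

End L2_Rvec.

Section sampling.
Context dO (Omega : measurableType dO) (R : realType) (P : probability Omega R).

(* The product rule for subfamilies is the case where some A i are setT. *)
Definition mutually_independent dT (T : measurableType dT) (n : nat)
    (X : 'I_n -> {RV P >-> T}) : Prop :=
  forall A : 'I_n -> set T, (forall i, measurable (A i)) ->
    P (\bigcap_(i in [set: 'I_n]) (X i @^-1` A i)) =
    (\prod_(i < n) P (X i @^-1` A i))%E.

Definition has_density (d : nat) (X : {RV P >-> Rvec R d}) (p : Rvec R d -> R) :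
    Prop :=
  forall A, measurable A ->
    distribution P X A = (\int[lebesgue_Rvec R d]_(x in A) (p x)%:E)%E.

Definition iid_with_density (d n : nat) (X : 'I_n -> {RV P >-> Rvec R d})
    (p : Rvec R d -> R) : Prop :=
  mutually_independent X /\ forall i, has_density (X i) p.

Section sample.
Context dT (T : measurableType dT) (n : nat).
Variable X : 'I_n -> {RV P >-> T}.

Definition sample (w : Omega) : n.-tuple T := [tuple X i w | i < n].

Let measurable_sample : measurable_fun setT sample.
Proof.
apply/measurable_fun_tnthP => i; rewrite (_ : _ \o _ = X i)//.
by apply/funext => w /=; rewrite tnth_mktuple.
Qed.

HB.instance Definition _ := @isMeasurableFun.Build _ _ Omega (n.-tuple T) sample
  measurable_sample.

End sample.

(* An estimator is a function of the sample with values in functions on R^d;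
   the risk is the integral of the squared L_2 loss against the joint law of
   the sample. *)
Definition risk (d n : nat) (X : 'I_n -> {RV P >-> Rvec R d})
    (phat : n.-tuple (Rvec R d) -> Rvec R d -> R) (p : Rvec R d -> R) : \bar R :=
  (\int[distribution P (sample X)]_s (L2norm (phat s \- p)%R ^+ 2))%E.

End sampling.

Definition lambda_hat (R : realType) (d n k : nat)
    (phi : 'I_k -> Rvec R d -> R) (s : n.-tuple (Rvec R d)) : 'rV[R]_k :=
  \row_j (n%:R^-1 * \sum_(i < n) phi j (tnth s i)).

Definition linear_aggregate (R : realType) (d n k : nat)
    (phi : 'I_k -> Rvec R d -> R) (s : n.-tuple (Rvec R d)) : Rvec R d -> R :=
  lincomb phi (lambda_hat phi s).

(* Main.v *)
(* Put theta_j = <phi_j, p>, which is also the mean of phi_j(X_1).  By Pythagoras,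
   the loss of sum_j c_j phi_j is sum_j (c_j - theta_j)^2 plus the squared
   distance from p to the span, attained at c = theta.  Hence the risk exceeds
   the oracle term by the sum over j of the variances of the empirical means of
   phi_j(X_i); by independence each equals Var(phi_j(X_1)) / n, and it is at most
   E(phi_j(X_1)^2) / n = (int phi_j^2 p) / n <= L / n. *)
Require Import Defs.
From HB Require Import structures.
From mathcomp Require Import all_boot all_order all_algebra.
From mathcomp Require Import all_classical all_reals all_analysis.
From mathcomp Require Import measurable_realfun ess_sup_inf ring.

Set Implicit Arguments.
Unset Strict Implicit.
Unset Printing Implicit Defensive.

Import Order.TTheory GRing.Theory Num.Theory.
Import numFieldNormedType.Exports.

Local Open Scope classical_set_scope.
Local Open Scope ring_scope.

(** * Integration against a measure with a density *)

Section density.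
Local Open Scope ereal_scope.
Context d (T : measurableType d) (R : realType).
Variables (nu : {finite_measure set T -> \bar R})
          (mu : {sigma_finite_measure set T -> \bar R}) (p : T -> R).
Hypothesis mp : measurable_fun setT p.
Hypothesis nuE : forall A, measurable A -> nu A = \int[mu]_(x in A) (p x)%:E.

(** [p] agrees [mu]-almost everywhere with the Radon-Nikodym derivative of [nu], since both have the
    same integral over every measurable set; the change of variables for that derivative then
    carries over to [p]. *)
Lemma ge0_integral_density (f : T -> \bar R) :
    measurable_fun setT f -> (forall x, 0 <= f x) ->
  \int[nu]_x f x = \int[mu]_x (f x * (p x)%:E).
Proof.
move=> mf f0.
have mpE : measurable_fun setT (EFin \o p) by exact/measurable_EFinP.
have numu : nu `<< mu.
  apply/null_content_dominatesP => A mA muA0.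
  rewrite nuE//; apply: null_set_integral => //.
  exact: measurable_funTS.
rewrite -(Radon_Nikodym_SigmaFinite.change_of_variables numu)//.
pose g := Radon_Nikodym_SigmaFinite.f nu mu.
have mg : measurable_fun setT g.
  exact: measurable_int (Radon_Nikodym_SigmaFinite.f_integrable numu).
apply: ae_eq_integral => //.
- exact: emeasurable_funM.
- exact: emeasurable_funM.
- apply: ae_eqe_mul2l; apply: integral_ae_eq => //.
    exact: Radon_Nikodym_SigmaFinite.f_integrable.
  by move=> E _ mE; rewrite -Radon_Nikodym_SigmaFinite.f_integral// nuE.
Qed.

(** As [p] is nonnegative, the positive and negative parts of [f * p] are those of [f] times [p],
    which reduces to the nonnegative case. *)
Lemma Rintegral_density (f : T -> R) :
    (forall x, 0 <= p x)%R -> nu.-integrable setT (EFin \o f) ->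
  (\int[nu]_x f x = \int[mu]_x (f x * p x))%R.
Proof.
move=> p0 intf; have /measurable_EFinP mf := measurable_int _ intf.
have ppos x : (EFin \o (fun x => f x * p x)%R)^\+ x = (EFin \o f)^\+ x * (p x)%:E.
  by rewrite !funeposE /= -!EFin_max -EFinM maxr_pMl// mul0r.
have pneg x : (EFin \o (fun x => f x * p x)%R)^\- x = (EFin \o f)^\- x * (p x)%:E.
  by rewrite !funenegE /= -!EFin_max -EFinM maxr_pMl// mul0r mulNr.
rewrite /Rintegral; congr fine; rewrite integralE [RHS]integralE.
under [in RHS]eq_integral do rewrite ppos.
under [X in _ = _ - X]eq_integral do rewrite pneg.
by rewrite !ge0_integral_density//;
  [exact/measurable_funeneg/measurable_EFinP|
   exact/measurable_funepos/measurable_EFinP].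
Qed.

End density.

(** * Square-integrable functions and orthonormal expansions *)

Section Lfun2.
Context d (T : measurableType d) (R : realType) (mu : {measure set T -> \bar R}).

Lemma Lnorm2_sqr (f : T -> R) :
  ('N[mu]_2%:E[EFin \o f] ^+ 2 = \int[mu]_x (f x ^+ 2)%:E)%E.
Proof.
transitivity ('N[mu]_2%:E[EFin \o f] `^ 2)%E.
  have := Lnorm_ge0 mu 2%:E (EFin \o f).
  move: ('N[mu]_2%:E[EFin \o f])%E => [r r0| _ |//].
    by rewrite -EFin_expe poweR_EFin powR_mulrn.
  (* Infinite norm: both forms of the square are [+oo]. *)
  by rewrite poweRyr// expe2 mulyy.
rewrite poweR_Lnorm//; apply: eq_integral => x _.
by rewrite /= powR_mulrn// real_normK// num_real.
Qed.

Lemma Lfun2P (f : T -> R) : f \in Lfun mu 2%:E <->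
  measurable_fun setT f /\ (\int[mu]_x (f x ^+ 2)%:E < +oo)%E.
Proof.
rewrite -Lnorm2_sqr; split.
  rewrite inE => /andP[]; rewrite !inE/= => mf lf; split=> //.
  by rewrite lte_mul_pinfty ?Lnorm_ge0// ge0_fin_numE ?Lnorm_ge0.
move=> [mf lf]; rewrite inE; apply/andP; split; rewrite inE//=.
rewrite /finite_norm; move: lf (Lnorm_ge0 mu 2%:E (EFin \o f)).
by move: ('N[mu]_2%:E[EFin \o f])%E => [r| |]; rewrite ?ltry// expe2 mulyy.
Qed.

Lemma integrable_Lfun2M (f g : T -> R) : f \in Lfun mu 2%:E ->
  g \in Lfun mu 2%:E -> mu.-integrable setT (EFin \o (fun x => f x * g x)).
Proof. by move=> Lf Lg; exact/Lfun1_integrable/(Lfun2_mul_Lfun1 Lf Lg). Qed.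

Lemma Lfun2_lincomb m (f : 'I_m -> T -> R) (c : 'I_m -> R) :
  (forall j, f j \in Lfun mu 2%:E) ->
  (fun x => \sum_(j < m) c j * f j x) \in Lfun mu 2%:E.
Proof.
(* Closure of [Lfun] under sums asks for an exponent of at least 1. *)
move=> Lf; have le12 : (1 <= 2%:E :> \bar R)%E by rewrite lee_fin ler1n.
rewrite (_ : (fun _ => _) = \sum_(j < m) (c j \o* f j)).
  by apply: rpred_sum => j _; apply: Lfun_scale.
by apply/funext => x; rewrite fct_sumE; apply: eq_bigr => j _ /=; rewrite mulrC.
Qed.

Lemma Rintegral_lincombM m (f : 'I_m -> T -> R) (c : 'I_m -> R) (g : T -> R) :
  (forall j, f j \in Lfun mu 2%:E) -> g \in Lfun mu 2%:E ->
  \int[mu]_x ((\sum_(j < m) c j * f j x) * g x) =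
  \sum_(j < m) c j * \int[mu]_x (f j x * g x).
Proof.
move=> Lf Lg.
have ifg j : mu.-integrable setT (EFin \o (fun x => f j x * g x)).
  exact: integrable_Lfun2M.
apply: EFin_inj; rewrite -sumEFin /Rintegral.
under eq_integral => x _.
  rewrite mulr_suml -sumEFin; under eq_bigr do rewrite -mulrA EFinM.
  over.
rewrite integral_sum//; last first.
  by move=> j; exact: (integrableZl measurableT (c j) (ifg j)).
rewrite (eq_bigr (fun j => (c j * \int[mu]_x (f j x * g x))%:E)) ?sumEFin//.
move=> j _; rewrite (integralZl measurableT (ifg j)) EFinM /Rintegral fineK//.
exact: (integrable_fin_num measurableT (ifg j)).
Qed.

(** Completing the square: with [theta_j] the integral of [f j * g], orthonormality gives the sum of
    [c_j ^ 2 - 2 c_j theta_j] plus the squared norm of [g]. The term left over is free of [c]. *)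
Lemma Lnorm2_sqr_lincombB m (f : 'I_m -> T -> R) (c : 'I_m -> R) (g : T -> R) :
  (forall j, f j \in Lfun mu 2%:E) -> g \in Lfun mu 2%:E ->
  (forall i j, \int[mu]_x (f i x * f j x) = (i == j)%:R) ->
  ('N[mu]_2%:E[EFin \o ((fun x => \sum_(j < m) c j * f j x) \- g)%R] ^+ 2 =
   (\sum_(j < m) (c j - \int[mu]_x (f j x * g x)) ^+ 2 +
    (\int[mu]_x (g x ^+ 2) - \sum_(j < m) (\int[mu]_x (f j x * g x)) ^+ 2)%R)%:E)%E.
Proof.
move=> Lf Lg orth; set u := fun x => _.
have Lu : u \in Lfun mu 2%:E by exact: Lfun2_lincomb.
have le12 : (1 <= 2%:E :> \bar R)%E by rewrite lee_fin ler1n.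
have Lug : (u \- g)%R \in Lfun mu 2%:E by rewrite -[(u \- g)%R]/(u - g) rpredB.
rewrite Lnorm2_sqr -[LHS]fineK; last first.
  exact/integrable_fin_num/Lfun2_integrable_sqr.
congr EFin; rewrite -/(Rintegral mu setT (fun x => (u \- g)%R x ^+ 2)).
transitivity (\int[mu]_x (u x * u x) - \int[mu]_x (u x * g x) *+ 2
              + \int[mu]_x (g x * g x)).
  have iuu := integrable_Lfun2M Lu Lu; have iug := integrable_Lfun2M Lu Lg.
  have igg := integrable_Lfun2M Lg Lg; have iug2 := integrableD measurableT iug iug.
  rewrite mulr2n -RintegralD// -RintegralB// -RintegralD//; last first.
    exact: (integrableB measurableT iuu iug2).
  by apply: eq_Rintegral => x _ /=; ring.
rewrite !Rintegral_lincombM//.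
(* Orthonormality recovers the coefficients: only the term [i = j] survives. *)
have uE j : \int[mu]_x (f j x * u x) = c j.
  under eq_Rintegral do rewrite mulrC.
  rewrite Rintegral_lincombM// (bigD1 j)//= orth eqxx mulr1 big1 ?addr0//.
  by move=> i /negbTE ij; rewrite orth ij mulr0.
under eq_bigr do rewrite uE.
under [in RHS]eq_bigr do rewrite sqrrB.
rewrite !big_split/= sumrN -sumrMnl.
under [in X in _ = _ + (X - _)]eq_Rintegral do rewrite expr2.
under eq_bigr do rewrite -expr2.
by ring.
Qed.

End Lfun2.

(** * Densities with bounded essential supremum *)

Section bounded_density.
Local Open Scope ereal_scope.
Context d (T : measurableType d) (R : realType) (mu : {measure set T -> \bar R}).

(* When mu setT = 0 the sup norm is 0 by convention, but every property holds
   almost everywhere. *)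
Lemma ae_le_Lnormy (f : T -> \bar R) (c : \bar R) :
  'N[mu]_+oo[f] <= c -> \forall x \ae mu, `|f x| <= c.
Proof.
rewrite unlock; case: ifPn => [_ /ess_supP//|mu0 _].
exists setT; split => //; apply/eqP; rewrite eq_le measure_ge0 andbT.
by rewrite leNgt.
Qed.

Variables (p : T -> R) (L : R).
Hypotheses (mp : measurable_fun setT p) (p0 : forall x, (0 <= p x)%R).
Hypotheses (L0 : (0 <= L)%R) (pL : 'N[mu]_+oo[EFin \o p] <= L%:E).

(** Almost everywhere [p <= L]. This is the source of the constant [L] in the risk bound. *)
Lemma integral_bounded_density (f : T -> R) :
  measurable_fun setT f -> (forall x, 0 <= f x)%R ->
  \int[mu]_x (f x * p x)%:E <= L%:E * \int[mu]_x (f x)%:E.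
Proof.
move=> mf f0.
rewrite -ge0_integralZl_EFin//; last 2 first.
- by move=> x _; rewrite lee_fin.
- exact/measurable_EFinP.
apply: ae_ge0_le_integral => //.
- by move=> x _; rewrite lee_fin mulr_ge0.
- by apply/measurable_EFinP; exact: measurable_funM.
- by move=> x _; rewrite mule_ge0 ?lee_fin.
- by apply/measurable_EFinP; exact: measurable_funM.
apply: filterS (ae_le_Lnormy pL) => x /= + _.
by rewrite !lee_fin (ger0_norm (p0 x)) mulrC => /ler_wpM2r; exact.
Qed.

(** Taking [f = p] in the bound above, the integral of [p * p] is at most [L] times the finite
    integral of [p]. *)
Lemma Lfun2_bounded_density : \int[mu]_x (p x)%:E < +oo -> p \in Lfun mu 2%:E.
Proof.
move=> poo; apply/Lfun2P; split => //.
under eq_integral do rewrite expr2.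
rewrite (le_lt_trans (integral_bounded_density mp p0))//.
by rewrite lte_mul_pinfty ?lee_fin.
Qed.

End bounded_density.

(** * Independence and product laws *)

Section independence.
Local Open Scope ereal_scope.
Context dO (Omega : measurableType dO) (R : realType) (P : probability Omega R).

Section pair.
Context d1 d2 (T1 : measurableType d1) (T2 : measurableType d2).
Variables (U : {RV P >-> T1}) (V : {RV P >-> T2}).
Hypothesis UV : forall A B, measurable A -> measurable B ->
  P ((U @^-1` A) `&` (V @^-1` B)) = P (U @^-1` A) * P (V @^-1` B).

(** By [UV], the law of [(U, V)] and the product of the two laws agree on rectangles, hence on all
    measurable sets; Fubini's theorem then splits the integral. *)
Lemma expectationM_independent (f : T1 -> R) (g : T2 -> R) :
  measurable_fun setT f -> measurable_fun setT g ->
  (f \o U)%FUN \in Lfun P 1 -> (g \o V)%FUN \in Lfun P 1 ->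
  ((f \o U) * (g \o V))%R \in Lfun P 1 ->
  'E_P[(f \o U) * (g \o V)] = 'E_P[f \o U] * 'E_P[g \o V].
Proof.
move=> mf mg /Lfun1_integrable fU /Lfun1_integrable gV /Lfun1_integrable fUgV.
pose W w := (U w, V w).
have mW : measurable_fun setT W.
  by apply/measurable_fun_pair; exact: measurable_funPT.
pose W' : {mfun Omega >-> (T1 * T2)%type} :=
  HB.pack W (isMeasurableFun.Build _ _ _ _ W mW).
pose D12 : probability (T1 * T2)%type R := distribution P W'.
pose D1 : probability T1 R := distribution P U.
pose D2 : probability T2 R := distribution P V.
pose h (z : T1 * T2) := (f z.1 * g z.2)%:E.
have mh : measurable_fun setT h.
  by apply/measurable_EFinP; apply: measurable_funM; exact: measurableT_comp.
have DW A : measurable A -> (D1 \x D2) A = D12 A.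
  by move=> mA; apply: product_measure_unique => // *; rewrite -UV.
(* Fubini needs integrability under the product law; it is transported from [P] through the equality
   of laws. *)
have ih : (D1 \x D2).-integrable setT h.
  have /integrableP[_ hoo] := integrable_pushforward mW mh fUgV measurableT.
  apply/integrableP; split => //; apply: le_lt_trans hoo.
  by rewrite (eq_measure_integral D12)// => A mA _; exact: DW.
have if1 : D1.-integrable setT (EFin \o f).
  by apply: integrable_pushforward => //; exact/measurable_EFinP.
have ig2 : D2.-integrable setT (EFin \o g).
  by apply: integrable_pushforward => //; exact/measurable_EFinP.
rewrite expectation.unlock.
transitivity (\int[D12]_z h z); first exact/esym/integral_distribution.
transitivity (\int[D1 \x D2]_z h z).
  by apply/esym; rewrite (eq_measure_integral D12)// => A mA _; exact: DW.
rewrite -integral12_prod_meas1//.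
have <- : \int[D1]_x (f x)%:E = \int[P]_w (f (U w))%:E.
  by apply: integral_distribution => //; exact/measurable_EFinP.
have <- : \int[D2]_x (g x)%:E = \int[P]_w (g (V w))%:E.
  by apply: integral_distribution => //; exact/measurable_EFinP.
rewrite -(fineK (integrable_fin_num measurableT ig2)) -integralZr//.
apply: eq_integral => x _; rewrite /fubini_F /h/=.
under eq_integral do rewrite EFinM.
by rewrite (integralZl measurableT ig2) fineK// integrable_fin_num.
Qed.

End pair.

Lemma mutually_independent_pair dT (T : measurableType dT) n
    (X : 'I_n -> {RV P >-> T}) (i j : 'I_n) (A B : set T) :
  mutually_independent X -> i != j -> measurable A -> measurable B ->
  P ((X i @^-1` A) `&` (X j @^-1` B)) = P (X i @^-1` A) * P (X j @^-1` B).
Proof.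
move=> indX ij mA mB.
(* Indices other than [i] and [j] get the whole space, whose factor in the product is 1. *)
pose C k := if k == i then A else if k == j then B else setT.
have mC k : measurable (C k) by rewrite /C; do 2 case: ifP => // _.
have := indX C mC; rewrite (bigD1 i)//= (bigD1 j)/=; last by rewrite eq_sym.
rewrite big1 => [|k /andP[/negbTE ki /negbTE kj]]; last first.
  by rewrite /C ki kj preimage_setT probability_setT.
rewrite mule1 {2 3}/C eqxx eq_sym (negbTE ij) eqxx => <-; congr (P _).
apply/seteqP; split => [w [Aw Bw] k _|w Cw].
  by rewrite /C; case: eqP => [->//|_]; case: eqP => [->//|].
have := Cw i Logic.I; have := Cw j Logic.I.
by rewrite /C eqxx eq_sym (negbTE ij) eqxx.
Qed.

End independence.

(** * Variance of a sum of uncorrelated variables *)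

Section variance_sum.
Local Open Scope ereal_scope.
Context d (T : measurableType d) (R : realType) (P : probability T R).

Lemma covariance_suml (I : Type) (s : seq I) (Y : I -> T -> R) (Z : T -> R) :
  (forall i, Y i \in Lfun P 2%:E) -> Z \in Lfun P 2%:E ->
  covariance P (\sum_(i <- s) Y i)%R Z = \sum_(i <- s) covariance P (Y i) Z.
Proof.
move=> LY LZ; have le12 : (1 <= 2%:E :> \bar R) by rewrite lee_fin ler1n.
elim: s => [|i s IHs]; first by rewrite !big_nil covariance_cst_l.
rewrite !big_cons -IHs -covarianceDl//.
by rewrite rpred_sum.
Qed.

(** Bilinearity turns the variance into a double sum of covariances, of which only the diagonal
    survives. *)
Lemma variance_sum (I : finType) (Y : I -> T -> R) :
  (forall i, Y i \in Lfun P 2%:E) ->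
  (forall i j, i != j -> covariance P (Y i) (Y j) = 0) ->
  'V_P[(\sum_i Y i)%R] = \sum_i 'V_P[Y i].
Proof.
move=> LY Y0; have le12 : (1 <= 2%:E :> \bar R) by rewrite lee_fin ler1n.
rewrite /variance covariance_suml//; last by rewrite rpred_sum.
apply: eq_bigr => i _.
rewrite covarianceC covariance_suml// (bigD1 i)//= big1 ?adde0//.
by move=> j; exact: Y0.
Qed.

End variance_sum.

(** * Mean squared error of an empirical mean *)

Section empirical_mean.
Context dO (Omega : measurableType dO) (R : realType) (P : probability Omega R).
Context (d : nat) (p : Rvec R d -> R) (L : R).
Hypotheses (L0 : 0 <= L) (hp : bounded_density L p).
Notation leb := (lebesgue_Rvec R d).

Let mp : measurable_fun setT p. Proof. by case: hp. Qed.
Let p0 x : 0 <= p x. Proof. by case: hp. Qed.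
Let pL : ('N[leb]_+oo[EFin \o p] <= L%:E)%E. Proof. by case: hp. Qed.

Section one_observation.
Variables (X : {RV P >-> Rvec R d}) (f : Rvec R d -> R).
Hypotheses (Xp : has_density X p) (Lf : f \in @L2 R d).

Let mf : measurable_fun setT f. Proof. by have /Lfun2P[] := Lf. Qed.

Let mff : measurable_fun setT (fun x => f x ^+ 2).
Proof. exact: measurable_funX. Qed.

Lemma second_moment_has_density :
  ('E_P[((f \o X) ^+ 2)%R] <= L%:E * \int[leb]_x (f x ^+ 2)%:E)%E.
Proof.
rewrite expectation.unlock.
have -> : (\int[P]_w (((f \o X) ^+ 2)%R w)%:E =
    \int[distribution P X]_x (f x ^+ 2)%:E)%E.
  rewrite ge0_integral_distribution//; first exact/measurable_EFinP.
  by move=> x; rewrite lee_fin sqr_ge0.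
rewrite (ge0_integral_density mp Xp)//.
- under eq_integral do rewrite -EFinM.
  by apply: integral_bounded_density => // x; rewrite sqr_ge0.
- exact/measurable_EFinP.
- by move=> x; rewrite lee_fin sqr_ge0.
Qed.

Lemma Lfun2_has_density : (f \o X)%FUN \in Lfun P 2%:E.
Proof.
apply/Lfun2P; split; first exact: measurableT_comp.
have := second_moment_has_density; rewrite expectation.unlock => /le_lt_trans.
apply; rewrite lte_mul_pinfty ?lee_fin//.
by have /Lfun2P[] := Lf.
Qed.

Lemma Lfun1_has_density : (f \o X)%FUN \in Lfun P 1.
Proof. by apply: (Lfun_subset12 _ Lfun2_has_density); exact: fin_num_measure. Qed.

Lemma expectation_has_density : ('E_P[f \o X] = (L2inner f p)%:E)%E.
Proof.
have /Lfun1_integrable iX := Lfun1_has_density.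
rewrite -[LHS]fineK ?expectation_fin_num ?Lfun1_has_density//; congr EFin.
rewrite /L2inner -(Rintegral_density mp Xp)//; last first.
  by apply: integrable_pushforward => //; exact/measurable_EFinP.
rewrite /Rintegral integral_distribution ?expectation.unlock//.
exact/measurable_EFinP.
Qed.

(** Dropping the squared mean leaves the second moment, already bounded through [p <= L]. *)
Lemma variance_has_density_le :
  ('V_P[f \o X] <= (L * \int[leb]_x (f x ^+ 2))%:E)%E.
Proof.
rewrite varianceE; last exact: Lfun2_has_density.
apply: (@le_trans _ _ 'E_P[((f \o X) ^+ 2)%R]%E).
  by rewrite geeDl// oppe_le0 sqre_ge0.
rewrite (le_trans second_moment_has_density)// EFinM /Rintegral fineK//.
exact/integrable_fin_num/Lfun2_integrable_sqr.
Qed.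

End one_observation.

(** The empirical mean is unbiased for [L2inner f p], so its mean squared error is its variance;
    independence makes this [n^-2] times a sum of [n] variances. *)
Lemma mse_empirical_mean (n : nat) (X : 'I_n -> {RV P >-> Rvec R d})
    (f : Rvec R d -> R) : (0 < n)%N -> iid_with_density X p -> f \in @L2 R d ->
  (\int[P]_w ((n%:R^-1 * \sum_(i < n) f (X i w) - L2inner f p) ^+ 2)%:E <=
   (L * \int[leb]_x (f x ^+ 2) / n%:R)%:E)%E.
Proof.
move=> n0 [indX Xp] Lf.
have le12 : (1 <= 2%:E :> \bar R)%E by rewrite lee_fin ler1n.
have mf : measurable_fun setT f by have /Lfun2P[] := Lf.
have L2X i : (f \o X i)%FUN \in Lfun P 2%:E by exact: Lfun2_has_density.
have L1X i : (f \o X i)%FUN \in Lfun P 1 by exact: Lfun1_has_density.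
pose S := (\sum_(i < n) (f \o X i))%R.
have L2S : S \in Lfun P 2%:E by rewrite rpred_sum.
have L1S : S \in Lfun P 1 by apply: (Lfun_subset12 _ L2S); exact: fin_num_measure.
have ES : 'E_P[n%:R^-1 \o* S]%E = (L2inner f p)%:E.
  rewrite expectationZl// /S -big_enum -(big_map (fun i => f \o X i) predT id)/=.
  rewrite expectation_sum => [|_ /mapP[i _ ->]//].
  rewrite big_map big_enum/=.
  under eq_bigr do rewrite expectation_has_density//.
  rewrite sumEFin sumr_const card_ord -EFinM -[L2inner f p *+ n]mulr_natl mulKf//.
  by rewrite pnatr_eq0 -lt0n.
have -> : (\int[P]_w ((n%:R^-1 * \sum_(i < n) f (X i w) - L2inner f p) ^+ 2)%:E =
    'V_P[n%:R^-1 \o* S])%E.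
  rewrite /variance covariance.unlock ES expectation.unlock.
  apply: eq_integral => w _; congr EFin.
  by rewrite /S/= !fctE/= fct_sumE mulrC expr2.
rewrite varianceZ// variance_sum//; last first.
  (* Distinct observations are independent, so the mean of the product factors and the covariance
     vanishes. *)
  move=> i j ij; rewrite covarianceE//; last exact: Lfun2_mul_Lfun1.
  rewrite expectationM_independent//; last exact: Lfun2_mul_Lfun1.
    by rewrite subee// fin_numM ?expectation_fin_num.
  by move=> A B; exact: mutually_independent_pair.
apply: (@le_trans _ _ ((n%:R^-1 ^+ 2)%:E *
    \sum_(i < n) (L * \int[leb]_x (f x ^+ 2))%:E)%E).
  rewrite lee_wpmul2l ?lee_fin ?sqr_ge0// lee_sum// => i _.
  exact: variance_has_density_le.
(* [n] equal terms times [n^-2] leave [1 / n]. *)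
rewrite sumEFin -EFinM lee_fin sumr_const card_ord -mulr_natl.
rewrite le_eqVlt; apply/orP; left; apply/eqP; field.
by rewrite pnatr_eq0 -lt0n.
Qed.

End empirical_mean.

(** * Spans up to null sets and Pythagoras in [L2] *)

Section L2_Rvec.
Context (R : realType) (d : nat).
Notation leb := (lebesgue_Rvec R d).

Lemma lincomb_L2 m (f : 'I_m -> Rvec R d -> R) (lam : 'rV[R]_m) :
  (forall j, f j \in @L2 R d) -> lincomb f lam \in @L2 R d.
Proof. exact: Lfun2_lincomb. Qed.

Lemma lincomb_span m (f : 'I_m -> Rvec R d -> R) (lam : 'rV[R]_m) :
  (forall j, f j \in @L2 R d) -> L2span f (lincomb f lam).
Proof.
move=> Lf; split; first exact: lincomb_L2.
by exists lam; apply: filterE.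
Qed.

(** [L2span] provides coefficients only up to a null set; this allows a change of representative
    inside the loss. *)
Lemma eq_ae_L2normB (f g p : Rvec R d -> R) :
  f \in @L2 R d -> g \in @L2 R d -> p \in @L2 R d -> f = g %[ae leb] ->
  (L2norm (f \- p)%R ^+ 2 = L2norm (g \- p)%R ^+ 2)%E.
Proof.
move=> /Lfun2P[mf _] /Lfun2P[mg _] /Lfun2P[mp _] fg.
rewrite /L2norm !Lnorm2_sqr; apply: ae_eq_integral => //.
- apply/measurable_EFinP; apply: measurable_funX; exact: measurable_funB.
- apply/measurable_EFinP; apply: measurable_funX; exact: measurable_funB.
- by apply: filterS fg => x /= ->.
Qed.

(** Both losses are expanded by [Lnorm2_sqr_lincombB]; at [c = theta] the sum of squares vanishes,
    which identifies the remaining term. *)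
Lemma L2normB_orthonormal m (phi : 'I_m -> Rvec R d -> R) (p : Rvec R d -> R)
    (theta := \row_(j < m) L2inner (phi j) p) (c : 'rV[R]_m) :
  (forall j, phi j \in @L2 R d) -> p \in @L2 R d ->
  (forall i j, L2inner (phi i) (phi j) = (i == j)%:R) ->
  (L2norm (lincomb phi c \- p)%R ^+ 2 =
   (\sum_(j < m) (c ord0 j - L2inner (phi j) p) ^+ 2)%R%:E +
   L2norm (lincomb phi theta \- p)%R ^+ 2)%E.
Proof.
move=> Lphi Lp orth.
rewrite /L2norm !Lnorm2_sqr_lincombB// -EFinD; congr EFin; congr +%R.
by rewrite [X in _ = X + _]big1 ?add0r// => j _; rewrite mxE subrr expr0n.
Qed.

End L2_Rvec.

(** * The oracle inequality: best approximation in the span, then estimation error *)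

Theorem theorem2p1 (R : realType) (d : nat) (L : R) (M n : nat)
    (hd : (1 <= d)%N) (hL : 0 < L) (hM : (2 <= M)%N) (hn : (1 <= n)%N)
    (p_ : 'I_M -> Rvec R d -> R) (hp_ : forall j, p_ j \in @L2 R d)
    (p : Rvec R d -> R) (hp : bounded_density L p)
    (dO : measure_display) (Omega : measurableType dO) (P : probability Omega R)
    (X : 'I_n -> {RV P >-> Rvec R d}) (hX : iid_with_density X p)
    (M' : nat) (hM' : (M' <= M)%N)
    (phi : 'I_M' -> Rvec R d -> R) (hphi : orthonormal_basis_of_span phi p_) :
  exists lam0 : 'rV[R]_M,
    (forall lam : 'rV[R]_M,
      (L2norm (lincomb p_ lam0 \- p)%R ^+ 2 <= L2norm (lincomb p_ lam \- p)%R ^+ 2)%E)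
    /\ (risk X (linear_aggregate phi) p <=
        L2norm (lincomb p_ lam0 \- p)%R ^+ 2 + (L * M%:R / n%:R)%:E)%E.
Proof.
have L0 := ltW hL; have [Lphi orth span_eq] := hphi.
have Lp : p \in @L2 R d.
  have [mp p0 p1 pL] := hp.
  by apply: (Lfun2_bounded_density mp p0 L0 pL); rewrite p1 ltry.
(* Coefficients of the orthogonal projection of [p] onto the span; [K] is the squared distance from
   [p] to it. *)
pose theta : 'rV[R]_M' := \row_j L2inner (phi j) p.
set K := (L2norm (lincomb phi theta \- p)%R ^+ 2)%E.
have K0 : (0 <= K)%E by exact: sqre_ge0.
(* The minimizer [lam0] expresses the projection, up to a null set, in terms of the [p_ j]. *)
have [_ [lam0 lam0E]] : L2span p_ (lincomb phi theta).
  by rewrite -span_eq; exact: lincomb_span.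
have lam0K : (L2norm (lincomb p_ lam0 \- p)%R ^+ 2 = K)%E.
  by apply/esym/eq_ae_L2normB => //; exact: lincomb_L2.
exists lam0; rewrite lam0K; split => [lam|].
  (* Any competitor is almost everywhere a combination of the [phi j], so its loss is [K] plus a sum
     of squares. *)
  have [_ [c cE]] : L2span phi (lincomb p_ lam).
    by rewrite span_eq; exact: lincomb_span.
  rewrite (eq_ae_L2normB _ _ Lp cE) ?lincomb_L2//.
  rewrite L2normB_orthonormal// -/theta -/K leeDr// lee_fin.
  by apply: sumr_ge0 => j _; rewrite sqr_ge0.
have mphi j : measurable_fun setT (phi j) by have /Lfun2P[] := Lphi j.
pose err (s : n.-tuple (Rvec R d)) j :=
  (lambda_hat phi s ord0 j - L2inner (phi j) p) ^+ 2.
have merr j : measurable_fun setT (fun s => (err s j)%:E).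
  apply/measurable_EFinP; apply: measurable_funX; apply: measurable_funB => //.
  under eq_fun do rewrite mxE.
  apply: measurable_funM => //; apply: measurable_sum => i.
  by apply: measurableT_comp => //; exact: measurable_tnth.
(* Pythagoras for each sample: the risk is [K] plus the expected squared errors of the
   coefficients. *)
rewrite /risk; under eq_integral => s _.
  rewrite L2normB_orthonormal// -/theta -/K -sumEFin; over.
have err0 j s : (0 <= (err s j)%:E)%E by rewrite lee_fin sqr_ge0.
rewrite ge0_integralD//; last 2 first.
- by move=> s _; apply: sume_ge0 => j _; exact: err0.
- by apply: emeasurable_sum => j; exact: merr.
rewrite (integral_cst _ measurableT K).
rewrite [X in (K * X)%E](_ : _ = 1%E); last first.
  exact: (probability_setT (distribution P (sample X))).
rewrite mule1 addeC leeD2l//.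
rewrite ge0_integral_sum//; last by move=> j s _; exact: err0.
apply: (@le_trans _ _ (\sum_(j < M') (L / n%:R)%:E)%E).
  apply: lee_sum => j _.
  rewrite ge0_integral_distribution; [|exact: merr|by move=> s; exact: err0].
  under eq_integral => w _.
    rewrite /= /err mxE; under eq_bigr do rewrite tnth_mktuple; over.
  apply: le_trans (mse_empirical_mean L0 hp hn hX (Lphi j)) _.
  (* Each [phi j] has unit norm, so the bound is [L / n]. *)
  rewrite lee_fin (_ : Rintegral _ _ _ = 1) ?mulr1//.
  transitivity (L2inner (phi j) (phi j)); last by rewrite orth eqxx.
  by apply: eq_Rintegral => x _; rewrite expr2.
(* The sum has [M'] terms, and [M' <= M]. *)
rewrite sumEFin lee_fin sumr_const card_ord -[leLHS]mulr_natl mulrA.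
rewrite ler_wpM2r ?invr_ge0// mulrC ler_wpM2l//.
by rewrite ler_nat.
Qed.
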